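(* Let $\varphi(\mathbf{x},\mathbf{y})$ be a prime P-encoding with input variables $x_1,\dots,x_n$, $n\ge 4$. Then at least one of the following holds: (a) there is a P-encoding $\varphi'$ with $n$ input variables such that $|\varphi|\ge|\varphi'|+1$; (b) there is a P-encoding $\varphi'$ with $n-1$ input variables such that $|\varphi|\ge|\varphi'|+3$; (c) $\varphi$ is in regular form. Moreover, if $\varphi$ is a 2-CNF formula, then $\varphi'$ in cases (a) and (b) can be taken to be a 2-CNF formula as well.
   Context: A literal is a boolean variable or its negation; a clause is a disjunction of a set of literals with no complementary pair; a CNF formula is a conjunction (set) of clauses, its size $|\varphi|$ is the number of clauses; a 2-CNF formula has all clauses of at most two literals. A clause $C$ is an implicate of $\varphi$ if every satisfying assignment of $\varphi$ satisfies $C$; it is prime if no proper subset of it is an implicate; $\varphi$ is prime if all its clauses are prime implicates of $\varphi$. Unit resolution: from a unit clause $l$ and a clause containing $\neg l$ derive the clause with $\neg l$ removed; $\varphi\wedge g_1\wedge\dots\wedge g_p\vdash_1 C$ means $C$ is derivable from $\varphi$ and the unit clauses $g_i$ by a sequence of unit resolutions. A formula $\varphi(\mathbf{x},\mathbf{y})$ with input variables $x_1,\dots,x_n$ ($n\ge1$) and auxiliary variables $\mathbf{y}$ is a P-encoding if (P1) $\varphi\wedge x_i$ is satisfiable for each $i$ and (P2) $\varphi\wedge x_i\vdash_1\neg x_j$ for all $i\ne j$. For each $i$ let $Q_{\varphi,i}=\{C\in\varphi : \neg x_i\in C\}$. A P-encoding $\varphi$ is in regular form if for each $i\in\{1,\dots,n\}$: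 (R1) $|Q_{\varphi,i}|=2$; (R2) the clauses in $Q_{\varphi,i}$ contain no input variable other than $x_i$; (R3) the clauses in $Q_{\varphi,i}$ are binary. *)

(* Defs.v *)
From mathcomp Require Import all_boot.

Set Implicit Arguments.
Unset Strict Implicit.
Unset Printing Implicit Defensive.

(* [inl i] is the input variable x_i, [inr k] the auxiliary variable y_k. *)
Definition var (n m : nat) : finType := ('I_n + 'I_m)%type.

(* [(v, true)] is the literal v and [(v, false)] its negation. *)
Definition lit (n m : nat) : finType := (var n m * bool)%type.

Definition neg_lit n m (l : lit n m) : lit n m := (l.1, ~~ l.2).

Definition posx n m (i : 'I_n) : lit n m := (inl i, true).
Definition negx n m (i : 'I_n) : lit n m := (inl i, false).

(* Arbitrary sets of literals; the absence of complementary pairs is imposed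
   on the clauses of a formula by [is_cnf], which [P_encoding] requires. *)
Definition clause (n m : nat) : finType := {set lit n m}.

(* The size of a formula [phi] is the cardinal [#|phi|]. *)
Definition formula (n m : nat) : finType := {set clause n m}.

Definition is_clause n m (C : clause n m) : Prop :=
  forall l, l \in C -> neg_lit l \notin C.

Definition is_cnf n m (phi : formula n m) : Prop :=
  forall C, C \in phi -> is_clause C.

Definition is_2cnf n m (phi : formula n m) : Prop :=
  forall C, C \in phi -> #|C| <= 2.

Definition assignment (n m : nat) := var n m -> bool.

Definition sat_clause n m (a : assignment n m) (C : clause n m) : Prop :=
  exists2 l, l \in C & a l.1 = l.2.

Definition sat n m (a : assignment n m) (phi : formula n m) : Prop :=
  forall C, C \in phi -> sat_clause a C.

Definition satisfiable n m (phi : formula n m) : Prop :=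
  exists a : assignment n m, sat a phi.

Definition implicate n m (phi : formula n m) (C : clause n m) : Prop :=
  forall a : assignment n m, sat a phi -> sat_clause a C.

Definition prime_implicate n m (phi : formula n m) (C : clause n m) : Prop :=
  implicate phi C /\ forall D : clause n m, D \proper C -> ~ implicate phi D.

Definition prime_formula n m (phi : formula n m) : Prop :=
  forall C, C \in phi -> prime_implicate phi C.

Definition unit_clause n m (l : lit n m) : clause n m := [set l].

Inductive unit_derivable n m (phi : formula n m) : clause n m -> Prop :=
| UnitDerivableAxiom C : C \in phi -> unit_derivable phi C
| UnitDerivableRes l C :
    unit_derivable phi (unit_clause l) -> unit_derivable phi C ->
    neg_lit l \in C -> unit_derivable phi (C :\ neg_lit l).

Definition and_lit n m (phi : formula n m) (l : lit n m) : formula n m :=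
  unit_clause l |: phi.

Definition P_encoding n m (phi : formula n m) : Prop :=
  [/\ 0 < n,
      is_cnf phi,
      forall i : 'I_n, satisfiable (and_lit phi (posx m i))
    & forall i j : 'I_n, i != j ->
        unit_derivable (and_lit phi (posx m i)) (unit_clause (negx m j))].

Definition Q n m (phi : formula n m) (i : 'I_n) : {set clause n m} :=
  [set C in phi | negx m i \in C].

Definition regular_form n m (phi : formula n m) : Prop :=
  P_encoding phi /\
  forall i : 'I_n,
    [/\ #|Q phi i| = 2,
        forall C, C \in Q phi i ->
          forall (j : 'I_n) (b : bool), (inl j, b) \in C -> j = i
      & forall C, C \in Q phi i -> #|C| = 2].

(* Main.v *)
Require Import Defs.
From mathcomp Require Import all_boot.

(** Let [-x_i \/ l] be a clause of a P-encoding.  If unit propagation from [x_i]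
    uses no clause of [Q_i] other than this one, then [x_i] can be replaced by
    [l] throughout: the clause becomes a tautology and one clause is saved.
    By primality only binary clauses of [Q_i] can take part in the propagation
    from [x_i], so case (a) holds unless every [Q_i] has two binary clauses.
    Setting [x_i] to false removes one input and all of [Q_i], so case (b)
    holds if [#|Q_i| >= 3].  Finally, if [-x_i \/ -x_j] is a clause, setting
    [x_j] to false removes the two clauses of [Q_j] and leaves a single clause
    [-x_i \/ l] in [Q_i]; then replacing [x_i] by [l] saves the third clause. *)

Set Implicit Arguments.
Unset Strict Implicit.
Unset Printing Implicit Defensive.

(** * Literals, satisfaction and unit propagation *)

Definition lit_true n m (a : assignment n m) (l : lit n m) : bool :=
  a l.1 == l.2.

(** Unit resolution restricted to its unit conclusions, so that inductions only meet original
    clauses and never intermediate resolvents. *)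
Inductive propagates n m (phi : formula n m) : lit n m -> Prop :=
| Propagates C t : C \in phi -> t \in C ->
    (forall q, q \in C -> q != t -> propagates phi (neg_lit q)) ->
    propagates phi t.

Definition Qlit n m (phi : formula n m) (p : lit n m) : {set clause n m} :=
  [set C in phi | neg_lit p \in C].

Definition is_clauseb n m (C : clause n m) : bool :=
  [forall l in C, neg_lit l \notin C].

(* Tautologies are dropped, so the result is a CNF for every map [s]. *)
Definition subst_formula n m n' m' (s : lit n m -> lit n' m')
  (phi : formula n m) : formula n' m' :=
  [set D in [set s @: (C : {set lit n m}) | C in phi]
   | is_clauseb (D : clause n' m')].

Definition assign_false n m (p : lit n m) (phi : formula n m) : formula n m :=
  [set (C :\ p : clause n m) | C in phi :\: Qlit phi p].

(* A P-encoding whose [k] inputs are arbitrary literals [g i]; the remaining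
   variables, inputs of type [inl] included, are auxiliary. *)
Record lit_encoding n m k (phi : formula n m) (g : 'I_k -> lit n m) : Prop :=
  LitEncoding {
    lit_enc_cnf : is_cnf phi;
    lit_enc_sat : forall i, satisfiable (and_lit phi (g i));
    lit_enc_prop : forall i j, i != j ->
      propagates (and_lit phi (g i)) (neg_lit (g j)) }.

Section Literals.
Variables n m : nat.
Implicit Types (phi psi : formula n m) (C : clause n m) (l p t : lit n m).
Implicit Types (a : assignment n m).

Lemma neg_litK : involutive (@neg_lit n m).
Proof. by case=> v b; rewrite /neg_lit /= negbK. Qed.

Lemma eq_neg_lit p t : (neg_lit p == t) = (p == neg_lit t).
Proof. by apply/eqP/eqP => [<-|->]; rewrite neg_litK. Qed.

Lemma neg_lit_neq l : neg_lit l != l.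
Proof. by case: l => v b; rewrite /neg_lit xpair_eqE eqxx /=; case: b. Qed.

Lemma lit_true_neg a l : lit_true a (neg_lit l) = ~~ lit_true a l.
Proof. by rewrite /lit_true /neg_lit /=; case: (a _) l.2 => [] []. Qed.

Lemma sat_clauseP a C :
  sat_clause a C <-> exists2 l, l \in C & lit_true a l.
Proof. by split=> -[l lC /eqP al]; exists l => //; apply/eqP. Qed.

Lemma is_clauseP C : reflect (is_clause C) (is_clauseb C).
Proof. exact: 'forall_implyP. Qed.

Lemma sat_and_lit a phi l :
  sat a (and_lit phi l) <-> lit_true a l /\ sat a phi.
Proof.
split=> [H|[al H] C].
  split; last by move=> C Cphi; apply: H; rewrite !inE Cphi orbT.
  have /sat_clauseP[q] : sat_clause a (unit_clause l) by apply: H; exact: setU11.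
  by rewrite inE => /eqP->.
case/setU1P=> [->|/H //]; apply/sat_clauseP; exists l => //; exact: set11.
Qed.

Lemma propagates_sound a phi t : sat a phi -> propagates phi t -> lit_true a t.
Proof.
move=> sa; elim=> C {}t Cphi tC _ IH.
have /sat_clauseP[q qC aq] := sa C Cphi.
have [<- //|qt] := eqVneq q t.
by have := IH q qC qt; rewrite lit_true_neg aq.
Qed.

Lemma propagates_lit phi l : propagates (and_lit phi l) l.
Proof.
apply: (@Propagates _ _ _ (unit_clause l)); rewrite ?setU11 ?set11 // => q.
by rewrite inE => /eqP->; rewrite eqxx.
Qed.

Lemma unit_derivable_propagates phi l :
  unit_derivable phi (unit_clause l) <-> propagates phi l.
Proof.
split=> [H|].
  (* Invariant: a derived clause is an original clause minus literals already refuted by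
     propagation. *)
  suff gen : forall D, unit_derivable phi D -> exists C, [/\ C \in phi,
      D \subset C & forall q, q \in C -> q \notin D -> propagates phi (neg_lit q)].
    have [C [Cphi sub out]] := gen _ H.
    apply: (Propagates Cphi); first by rewrite (subsetP sub) ?set11.
    by move=> q qC ql; apply: out; rewrite ?inE.
  move=> D {H}; elim=> {D} [C Cphi|p D _ [C1 [C1phi sub1 out1]] _ [C [Cphi sub out]] pD].
    by exists C; split=> // q ->.
  exists C; split=> //; first exact: subset_trans (subD1set _ _) sub.
  move=> q qC; rewrite !inE negb_and negbK => /orP[/eqP->|]; last exact: out.
  rewrite neg_litK; apply: (Propagates C1phi).
    by rewrite (subsetP sub1) ?set11.
  by move=> r rC rp; apply: out1; rewrite ?inE.
elim=> C t Cphi tC _ IH.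
(* Conversely, the literals of [C] other than [t] are resolved away one at a time; [k] bounds those
   that remain. *)
suff gen : forall k (D : clause n m), #|D| <= k -> D \subset C -> t \in D ->
    unit_derivable phi D -> unit_derivable phi (unit_clause t).
  by apply: (gen #|C| C) => //; exact: UnitDerivableAxiom.
elim=> [|k IHk] D; first by rewrite leqn0 cards_eq0 => /eqP->; rewrite inE.
move=> cardD sub tD der; have [eqD|] := eqVneq D [set t]; first by rewrite /unit_clause -eqD.
rewrite eqEsubset andbC sub1set tD /= => /subsetPn[q qD].
rewrite inE => qt.
have qC := subsetP sub _ qD.
have derq := UnitDerivableRes (IH q qC qt) der.
rewrite neg_litK in derq; apply: (IHk (D :\ q)); last exact: derq.
- by move: cardD; rewrite (cardsD1 q) qD.
- exact: subset_trans (subD1set _ _) sub.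
- by rewrite !inE eq_sym qt tD.
Qed.

(* Propagation from [p] enters the rest of the formula only through [Qlit phi p]. *)
Lemma propagates_from phi psi p t :
  satisfiable (and_lit phi p) -> phi :\: Qlit phi p \subset psi ->
  (forall C q, C \in Qlit phi p -> q \in C -> q != neg_lit p ->
     (forall r, r \in C -> r != q -> propagates (and_lit phi p) (neg_lit r)) ->
     propagates psi q) ->
  propagates (and_lit phi p) t -> t = p \/ propagates psi t.
Proof.
move=> [a sa] /subsetP sub use; have [ap _] := (sat_and_lit _ _ _).1 sa.
elim=> C {}t Cphi tC up IH.
have at_ : lit_true a t by apply: propagates_sound sa _; apply: Propagates Cphi tC up.
case/setU1P: Cphi => [eqC|Cphi].
  by left; move: tC; rewrite eqC inE => /eqP.
right; have [Cp|Cp] := boolP (neg_lit p \in C).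
  apply: (use C) => //; first by rewrite inE Cphi.
  by apply: contraTneq at_ => ->; rewrite lit_true_neg ap.
apply: (@Propagates _ _ _ C) => //.
  by apply: sub; rewrite !inE Cphi (negPf Cp).
move=> q qC qt; case: (IH q qC qt) => // eqp.
by move: Cp; rewrite -eqp neg_litK qC.
Qed.

End Literals.

(** * Substitution of literals *)

Section Substitution.
Variables (n m n' m' : nat) (s : lit n m -> lit n' m').
Implicit Types (phi psi : formula n m).
Hypothesis sN : forall l, s (neg_lit l) = neg_lit (s l).

Lemma subst_formula_cnf phi : is_cnf (subst_formula s phi).
Proof. by move=> D; rewrite inE => /andP[_ /is_clauseP]. Qed.

Lemma subst_formula_2cnf phi : is_2cnf phi -> is_2cnf (subst_formula s phi).
Proof.
move=> H D; rewrite inE => /andP[/imsetP[C /H leC ->] _].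
exact: leq_trans (leq_imset_card _ _) leC.
Qed.

Lemma card_subst_formula phi : #|subst_formula s phi| <= #|phi|.
Proof.
apply: leq_trans (leq_imset_card (fun C : {set lit n m} => s @: C) phi).
by apply/subset_leq_card/subsetP=> D; rewrite inE => /andP[].
Qed.

Lemma card_subst_formula_taut phi (C : clause n m) :
  C \in phi -> ~~ is_clauseb (s @: C : clause n' m') ->
  #|subst_formula s phi| < #|phi|.
Proof.
move=> Cphi tautC; rewrite (cardsD1 C phi) Cphi ltnS.
apply: leq_trans (leq_imset_card (fun C : {set lit n m} => s @: C) _).
apply/subset_leq_card/subsetP=> D; rewrite inE => /andP[/imsetP[E Ephi ->] clE].
apply/imsetP; exists E => //; rewrite !inE Ephi andbT.
by apply: contraNneq tautC => <-.
Qed.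

Lemma sat_subst_formula (a : assignment n m) (a' : assignment n' m') phi :
  (forall l, lit_true a' (s l) = lit_true a l) ->
  sat a phi -> sat a' (subst_formula s phi).
Proof.
move=> eqa sa D; rewrite inE => /andP[/imsetP[C /sa /sat_clauseP[l lC al] ->] _].
by apply/sat_clauseP; exists (s l); rewrite ?imset_f ?eqa.
Qed.

Lemma propagates_subst (psi : formula n m) (psi' : formula n' m') t :
  (forall C, C \in psi -> is_clauseb (s @: C : clause n' m') -> s @: C \in psi') ->
  satisfiable psi' -> propagates psi t -> propagates psi' (s t).
Proof.
move=> img [a sa]; elim=> C {}t Cpsi tC _ IH.
have [clC|] := boolP (is_clauseb (s @: C : clause n' m')).
  apply: Propagates (img _ Cpsi clC) _ _; first exact: imset_f.
  move=> _ /imsetP[q qC ->] qt; rewrite -sN; apply: IH => //.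
  by apply: contraNneq qt => ->.
rewrite negb_forall => /existsP[p']; rewrite negb_imply negbK.
case/andP=> /imsetP[p pC ->] /imsetP[q qC eqpq].
(* The image of [C] is a tautology and may be missing from [psi']. If one of the clashing literals
   is [t], refuting the other already yields [s t]; if neither is, two complementary literals are
   propagated, against satisfiability. *)
have [pt|pt] := eqVneq p t; have [qt|qt] := eqVneq q t.
- by move/eqP: eqpq; rewrite pt qt (negPf (neg_lit_neq _)).
- by have := IH q qC qt; rewrite sN -eqpq neg_litK pt.
- by have := IH p pC pt; rewrite sN eqpq qt.
- have := propagates_sound sa (IH p pC pt).
  have := propagates_sound sa (IH q qC qt).
  by rewrite !sN -eqpq neg_litK lit_true_neg => ->.
Qed.

Lemma propagates_subst_and_lit phi psi p t : psi \subset phi ->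
  satisfiable (and_lit (subst_formula s phi) (s p)) ->
  propagates (and_lit psi p) t ->
  propagates (and_lit (subst_formula s phi) (s p)) (s t).
Proof.
move=> /subsetP sub; apply: propagates_subst => C /setU1P[->|Cpsi] clC.
  by rewrite imset_set1 setU11.
by apply/setU1P; right; rewrite inE clC imset_f ?sub.
Qed.

End Substitution.

(** * Encodings whose inputs are arbitrary literals *)

Lemma P_encoding_lit_encoding n m (phi : formula n m) :
  P_encoding phi -> lit_encoding phi (@posx n m).
Proof.
case=> _ cnf sa pr; split=> // i j ij.
exact/unit_derivable_propagates/pr.
Qed.

Section LitEncoding.
Variables (n m k : nat) (phi : formula n m) (g : 'I_k -> lit n m).
Hypothesis enc : lit_encoding phi g.

Lemma lit_enc_true_inj a i j :
  sat a phi -> lit_true a (g i) -> lit_true a (g j) -> i = j.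
Proof.
move=> sa ai aj; apply/eqP; apply: contraTT aj => ij; rewrite -lit_true_neg.
by apply: propagates_sound (lit_enc_prop enc ij); apply/sat_and_lit.
Qed.

Lemma lit_enc_neg i j :
  i != j -> exists2 a, sat a phi & lit_true a (g i) && ~~ lit_true a (g j).
Proof.
move=> ij; have [a /sat_and_lit[ai sa]] := lit_enc_sat enc i.
exists a => //; rewrite ai; apply: contra ij => aj.
by apply/eqP; apply: lit_enc_true_inj sa ai aj.
Qed.

(** Two inputs on one variable would be complementary, so one of them would hold in every model; a
    model of a third input falsifies both. *)
Lemma lit_enc_var_inj : 2 < k -> injective (fun i => (g i).1).
Proof.
move=> k3 i j /= eqv; apply/eqP; apply/negPn/negP=> ij.
have [a sa] := lit_enc_neg ij; rewrite /lit_true eqv => /andP[ai aj].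
have : 0 < #|~: [set i; j]|.
  by rewrite cardsCs setCK card_ord cards2 ij subn_gt0.
case/card_gt0P=> r; rewrite !inE negb_or => /andP[ri rj].
have [b /sat_and_lit[br sb]] := lit_enc_sat enc r.
have bi : ~~ lit_true b (g i).
  by apply: contra ri => bi; apply/eqP; apply: lit_enc_true_inj sb br bi.
have bj : ~~ lit_true b (g j).
  by apply: contra rj => bj; apply/eqP; apply: lit_enc_true_inj sb br bj.
move: ai aj bi bj; rewrite /lit_true eqv.
by case: (a _) (b _) (g i).2 (g j).2 => [] [] [] [].
Qed.

Lemma lit_encoding_realize : 2 < k ->
  exists m' (phi' : formula k m'),
    [/\ P_encoding phi', is_2cnf phi -> is_2cnf phi' & #|phi'| <= #|phi|].
Proof.
move=> k3; have injv := lit_enc_var_inj k3.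
(* Every old variable gets an auxiliary name, even those that become inputs: the size of a formula
   counts clauses only. The sign in [s] is chosen so that [g i] becomes the positive literal. *)
pose m' := #|{: var n m}|.
pose s (l : lit n m) : lit k m' :=
  if [pick i | (g i).1 == l.1] is Some i then (inl i, l.2 == (g i).2)
  else (inr (enum_rank l.1), l.2).
have sN l : s (neg_lit l) = neg_lit (s l).
  rewrite /s /neg_lit /=; case: pickP => //= i _.
  by case: l.2 (g i).2 => [] [].
have sg i : s (g i) = posx m' i.
  rewrite /s; case: pickP => [j /eqP/injv->|/(_ i)]; last by rewrite eqxx.
  by rewrite eqxx.
pose tr (a : assignment n m) : assignment k m' :=
  fun v => match v with inl i => lit_true a (g i) | inr y => a (enum_val y) end.
have trE a l : lit_true (tr a) (s l) = lit_true a l.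
  rewrite /s; case: pickP => [i /eqP eqv|_]; rewrite /lit_true /=.
    by rewrite /lit_true eqv; case: (a _) l.2 (g i).2 => [] [] [].
  by rewrite enum_rankK.
have sat' i : satisfiable (and_lit (subst_formula s phi) (posx m' i)).
  have [a /sat_and_lit[ai sa]] := lit_enc_sat enc i.
  exists (tr a); apply/sat_and_lit; split; first by rewrite -sg trE.
  exact: (sat_subst_formula (trE a)).
exists m', (subst_formula s phi); split.
- split=> //; first exact: ltn_trans k3.
    exact: subst_formula_cnf.
  move=> i j ij; apply/unit_derivable_propagates.
  have -> : negx m' j = s (neg_lit (g j)) by rewrite sN sg.
  rewrite -sg; apply: (propagates_subst_and_lit sN (subxx phi)).
    by rewrite sg.
  exact: lit_enc_prop.
- exact: subst_formula_2cnf.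
- exact: card_subst_formula.
Qed.

(** The last hypothesis says that propagation from [g i] through its clauses can only yield [l].
    Hence [l] alone refutes every other input, and [g i] and [l] agree in all models that make some
    input true; identifying them preserves these models. *)
Lemma lit_encoding_substitute i l : 2 < k ->
  [set neg_lit (g i); l] \in phi -> l != neg_lit (g i) ->
  (forall C t, C \in Qlit phi (g i) -> t \in C -> t != neg_lit (g i) ->
     (forall q, q \in C -> q != t ->
        propagates (and_lit phi (g i)) (neg_lit q)) -> t = l) ->
  exists (phi' : formula n m) (g' : 'I_k -> lit n m),
    [/\ lit_encoding phi' g', is_2cnf phi -> is_2cnf phi' & #|phi'| < #|phi|].
Proof.
move=> k3 C1phi lNg only.
have lg : l != g i.
  apply: contraTneq (set21 (neg_lit (g i)) l) => eql.
  by apply: (lit_enc_cnf enc C1phi); rewrite eql set22.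
pose s t := if t == g i then l else if t == neg_lit (g i) then neg_lit l else t.
have sgi : s (g i) = l by rewrite /s eqxx.
have sl : s l = l by rewrite /s (negPf lg) (negPf lNg).
have sN t : s (neg_lit t) = neg_lit (s t).
  rewrite /s eq_neg_lit (inj_eq (can_inj (@neg_litK n m))).
  have [-> | _] := eqVneq t (g i).
    by rewrite eq_sym (negPf (neg_lit_neq _)).
  by have [_|_] := eqVneq t; rewrite ?neg_litK.
have up_l t : propagates (and_lit phi (g i)) t ->
    t = g i \/ propagates (and_lit (phi :\: Qlit phi (g i)) l) t.
  apply: propagates_from; [exact: lit_enc_sat | exact: subsetUr |].
  by move=> C q CQ qC qN up; rewrite (only C q) //; exact: propagates_lit.
have up_lj j : i != j -> propagates (and_lit (phi :\: Qlit phi (g i)) l) (neg_lit (g j)).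
  move=> ij; case: (up_l _ (lit_enc_prop enc ij)) => // eqg.
  have /(lit_enc_var_inj k3) eqij : (g i).1 = (g j).1 by rewrite -eqg.
  by rewrite eqij eqxx in ij.
have sat_s a : lit_true a (g i) = lit_true a l ->
    forall t, lit_true a (s t) = lit_true a t.
  move=> eqa t; rewrite /s; have [->|_] := eqVneq; first by rewrite eqa.
  by have [->|_] := eqVneq; rewrite // !lit_true_neg eqa.
have satS j : satisfiable (and_lit (subst_formula s phi) (s (g j))).
  have [a /sat_and_lit[aj sa]] := lit_enc_sat enc j.
  suff eqa : lit_true a (g i) = lit_true a l.
    exists a; apply/sat_and_lit; rewrite sat_s //; split=> //.
    exact: sat_subst_formula (sat_s a eqa) sa.
  (* If [i = j], the clause forces [l]. Otherwise [g i] is false, and so is [l], since [l] would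
     propagate the negation of [g j]. *)
  have [eqij|ij] := eqVneq i j.
    have /sat_clauseP[q] := sa _ C1phi.
    by rewrite !inE => /orP[]/eqP->; rewrite ?lit_true_neg eqij aj // => ->.
  have -> : lit_true a (g i) = false.
    by apply: contraNF ij => ai; apply/eqP; apply: lit_enc_true_inj sa ai aj.
  apply/esym/negbTE/negP=> al; move: aj; apply/negP; rewrite -lit_true_neg.
  apply: propagates_sound (up_lj j ij); apply/sat_and_lit; split=> //.
  by move=> C; rewrite inE => /andP[_ /sa].
exists (subst_formula s phi), (s \o g); split.
- split=> //=; first exact: subst_formula_cnf.
  move=> j r jr; rewrite -sN; have [eqji|ji] := eqVneq j i.
    have sat_l : satisfiable (and_lit (subst_formula s phi) (s l)).
      by rewrite sl -sgi.
    have -> : s (g j) = s l by rewrite eqji sgi sl.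
    apply: propagates_subst_and_lit (subsetDl phi (Qlit phi (g i))) sat_l _ => //.
    by apply: up_lj; rewrite -eqji.
  apply: propagates_subst_and_lit (subxx phi) (satS j) _ => //.
  exact: lit_enc_prop.
- exact: subst_formula_2cnf.
(* The clause [[set neg_lit (g i); l]] becomes a tautology and is dropped. *)
- apply: card_subst_formula_taut C1phi _; apply/is_clauseP=> /(_ l).
  rewrite imsetU1 imset_set1 sN sgi sl set22 => /(_ isT).
  by rewrite set21.
Qed.

End LitEncoding.

(** * Setting an input to false *)

Lemma card_assign_false n m (p : lit n m) phi :
  #|assign_false p phi| + #|Qlit phi p| <= #|phi|.
Proof.
have sub : Qlit phi p \subset phi by apply/subsetP=> C; rewrite inE => /andP[].
rewrite -(cardsID (Qlit phi p) phi) (setIidPr sub) addnC leq_add2l.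
exact: leq_imset_card.
Qed.

Lemma assign_false_2cnf n m (p : lit n m) phi :
  is_2cnf phi -> is_2cnf (assign_false p phi).
Proof.
move=> H _ /imsetP[C /setDP[/H leC _] ->].
exact: leq_trans (subset_leq_card (subD1set _ _)) leC.
Qed.

Lemma lit_encoding_assign_false n m k (phi : formula n m)
    (g : 'I_k.+1 -> lit n m) j :
  lit_encoding phi g -> lit_encoding (assign_false (g j) phi) (g \o lift j).
Proof.
move=> enc; set phi1 := assign_false _ _.
have sat1 a r : sat a (and_lit phi (g (lift j r))) ->
    ~~ lit_true a (g j) /\ sat a (and_lit phi1 (g (lift j r))).
  case/sat_and_lit=> ar sa.
  have aj : ~~ lit_true a (g j).
    apply: contra (neq_lift j r) => aj.
    by apply/eqP; apply: (lit_enc_true_inj enc) sa aj ar.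
  split=> //; apply/sat_and_lit; split=> // _ /imsetP[C /setDP[/sa /sat_clauseP[l lC al] _] ->].
  apply/sat_clauseP; exists l => //; rewrite !inE lC andbT.
  by apply: contraNneq aj => <-.
split=> /=.
- move=> _ /imsetP[C /setDP[Cphi _] ->] l.
  rewrite !inE => /andP[_ lC]; rewrite negb_and.
  by rewrite (lit_enc_cnf enc Cphi lC) orbT.
- by move=> r; have [a /sat1[_ sa]] := lit_enc_sat enc (lift j r); exists a.
move=> r r' rr'.
have [a sa] := lit_enc_sat enc (lift j r); have [aj _] := sat1 a r sa.
(* The only propagated literal that can be lost is [neg_lit (g j)]; its sole use is to refute [g j],
   which has been deleted from all clauses. *)
suff gen t : propagates (and_lit phi (g (lift j r))) t ->
    t = neg_lit (g j) \/ propagates (and_lit phi1 (g (lift j r))) t.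
  have [|eqg|//] := gen (neg_lit (g (lift j r'))).
    by apply: lit_enc_prop; rewrite // (inj_eq lift_inj).
  have /(lit_enc_neg enc)[b _] := neq_lift j r'.
  by rewrite (can_inj (@neg_litK n m) eqg) andbN.
elim=> C {}t Cphi tC up IH.
have at_ : lit_true a t by apply: propagates_sound sa _; apply: Propagates Cphi tC up.
case/setU1P: Cphi => [eqC|Cphi].
  by right; move: tC; rewrite eqC inE => /eqP->; exact: propagates_lit.
have tj : t != g j by apply: contraNneq aj => <-.
(* A dropped clause could yield another literal only after propagating [g j], which is false in the
   model [a]. *)
have [Cj|Cj] := boolP (neg_lit (g j) \in C).
  have [->|jt] := eqVneq t (neg_lit (g j)); first by left.
  rewrite eq_sym in jt; have := propagates_sound sa (up _ Cj jt).
  by rewrite neg_litK (negPf aj).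
right; apply: (@Propagates _ _ _ (C :\ g j)); last 1 first.
- move=> q; rewrite !inE => /andP[qj qC] qt.
  by case: (IH q qC qt) => // /(can_inj (@neg_litK n m)) eqq; rewrite eqq eqxx in qj.
- by apply/setU1P; right; apply/imsetP; exists C; rewrite // !inE Cphi (negPf Cj).
- by rewrite !inE tj tC.
Qed.

(** * Consequences of primality *)

Section PrimeEncoding.
Variables (n m : nat) (phi : formula n m).
Hypotheses (n2 : 1 < n) (enc : lit_encoding phi (@posx n m)).
Hypothesis prime_phi : prime_formula phi.

Lemma Qlit_posx i : Qlit phi (posx m i) = Q phi i.
Proof. by apply/setP=> C; rewrite !inE. Qed.

(** A clause [[set negx m i; posx m j]] would fail in a model where [x_i] is true and hence [x_j]
    false. *)
Lemma Q_posx i j C : C \in Q phi i -> #|C| = 2 -> posx m j \notin C.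
Proof.
rewrite inE => /andP[Cphi Ci] card2; apply/negP=> Cj.
have ij : i != j.
  by apply: contraTneq Cj => <-; apply: (lit_enc_cnf enc Cphi Ci).
have [a sa /andP[ai aj]] := lit_enc_neg enc ij.
have /sat_clauseP[l lC al] := sa C Cphi.
have eqC : C = [set negx m i; posx m j].
  apply/eqP; rewrite eq_sym eqEcard card2 cards2 xpair_eqE andbF andbT.
  by apply/subsetP=> t; rewrite !inE => /orP[]/eqP->.
move: lC al; rewrite eqC !inE => /orP[]/eqP->; last by rewrite (negPf aj).
by rewrite (lit_true_neg a (posx m i)) ai.
Qed.

(* If [d] in [C] were falsified by propagation from [x_i], then [C :\ d] would
   still be an implicate. *)
Lemma prime_not_propagated i C d : C \in Q phi i -> d \in C -> d != negx m i ->
  ~ propagates (and_lit phi (posx m i)) (neg_lit d).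
Proof.
rewrite inE => /andP[Cphi Ci] dC di up.
have [_ /(_ _ (properD1 dC))] := prime_phi Cphi; apply=> a sa.
have [ai|ai] := boolP (lit_true a (posx m i)); last first.
  apply/sat_clauseP; exists (negx m i); first by rewrite !inE eq_sym di.
  by rewrite (lit_true_neg a (posx m i)).
have /sat_clauseP[l lC al] := sa C Cphi.
apply/sat_clauseP; exists l => //; rewrite !inE lC andbT.
apply: contraTneq al => ->; rewrite -lit_true_neg.
by apply: propagates_sound up; apply/sat_and_lit.
Qed.

(** Any third literal of [C] would be refuted by propagation from [x_i], which primality forbids. *)
Lemma prime_propagated_binary i C t : C \in Q phi i -> t \in C -> t != negx m i ->
  (forall q, q \in C -> q != t ->
     propagates (and_lit phi (posx m i)) (neg_lit q)) ->
  C = [set negx m i; t].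
Proof.
move=> CQ tC ti up; apply/eqP; rewrite eq_sym eqEsubset; apply/andP; split.
  apply/subsetP=> q; rewrite !inE => /orP[]/eqP-> //.
  by move: CQ; rewrite inE => /andP[].
apply/subsetP=> q qC; rewrite !inE; apply/norP=> -[qi qt].
exact: prime_not_propagated CQ qC qi (up q qC qt).
Qed.

Lemma Q_binary_exists i : exists2 l, l != negx m i & [set negx m i; l] \in phi.
Proof.
have [l /andP[]|none] :=
  pickP [pred l | (l != negx m i) && ([set negx m i; l] \in phi)].
  by exists l.
have : 0 < #|[set~ i]| by rewrite cardsC1 card_ord -ltnS prednK // (ltn_trans _ n2).
case/card_gt0P=> j; rewrite !inE eq_sym => ij.
(* Without a binary clause, propagation from [x_i] never enters [Q phi i], so [phi] alone would
   propagate the negation of [x_j], against the satisfiability of [x_j]. *)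
have [|//|up] := propagates_from (lit_enc_sat enc i) (subsetDl _ _) _ (lit_enc_prop enc ij).
  move=> C q; rewrite Qlit_posx => CQ qC qi up.
  have := none q; rewrite /= qi -(prime_propagated_binary CQ qC qi up).
  by move: CQ; rewrite inE => /andP[->].
have [a /sat_and_lit[aj sa]] := lit_enc_sat enc j.
by have := propagates_sound sa up; rewrite lit_true_neg aj.
Qed.

Lemma Q_binaryP i C : C \in Q phi i -> #|C| = 2 ->
  exists2 l, l != negx m i & C = [set negx m i; l].
Proof.
rewrite inE => /andP[_ Ci] /eqP; rewrite (cardsD1 (negx m i)) Ci eqSS.
case/cards1P=> l eqC; exists l; last by rewrite -eqC setD1K.
have : l \in C :\ negx m i by rewrite eqC set11.
by rewrite !inE => /andP[].
Qed.

End PrimeEncoding.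

(** * Smaller encodings and the case distinction *)

Definition smaller_encoding n m (phi : formula n m) k d : Prop :=
  exists m' (phi' : formula k m'),
    [/\ P_encoding phi', is_2cnf phi -> is_2cnf phi' & #|phi'| + d <= #|phi|].

Lemma smaller_encoding_lit n m (phi psi : formula n m) k d (g : 'I_k -> lit n m) :
  2 < k -> lit_encoding psi g -> (is_2cnf phi -> is_2cnf psi) ->
  #|psi| + d <= #|phi| -> smaller_encoding phi k d.
Proof.
move=> k3 enc two le; have [m' [phi' [enc' two' le']]] := lit_encoding_realize enc k3.
exists m', phi'; split=> // [/two /two' //|].
by apply: leq_trans le; rewrite leq_add2r.
Qed.

Lemma few_binary_smaller n m (phi : formula n m) i : 2 < n ->
  P_encoding phi -> prime_formula phi ->
  #|[set C in Q phi i | #|C| == 2]| <= 1 -> smaller_encoding phi n 1.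
Proof.
move=> n3 /P_encoding_lit_encoding enc pr few.
have [l li C1phi] := Q_binary_exists (ltnW n3) enc pr i.
have [|psi [g [encg two lt]]] := lit_encoding_substitute enc (i := i) (l := l) n3 C1phi li.
  move=> C t; rewrite Qlit_posx => CQ tC ti up.
  have eqC := prime_propagated_binary pr CQ tC ti up.
  have inB p : p != negx m i -> [set negx m i; p] \in phi ->
      [set negx m i; p] \in [set C in Q phi i | #|C| == 2].
    by move=> pi pphi; rewrite !inE pphi cards2 eqxx eq_sym pi.
  have tphi : [set negx m i; t] \in phi.
    by rewrite -eqC; move: CQ; rewrite inE => /andP[].
  (* Both clauses are binary members of [Q phi i], which has at most one such member, so [t = l]. *)
  have /setP/(_ t) := card_le1_eqP few _ _ (inB _ li C1phi) (inB _ ti tphi).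
  by rewrite !inE eqxx orbT (negPf ti) => /esym/eqP.
by apply: smaller_encoding_lit encg two _; rewrite // addn1.
Qed.

(** The bound concerns the inputs that remain: three are needed to turn them back into distinct
    variables, whence [4 <= n] in the theorem. *)
Lemma many_Q_smaller n m (phi : formula n.+1 m) i : 2 < n ->
  P_encoding phi -> 2 < #|Q phi i| -> smaller_encoding phi n 3.
Proof.
move=> n3 /P_encoding_lit_encoding enc many.
apply: smaller_encoding_lit (lit_encoding_assign_false i enc) _ _ => //.
  exact: assign_false_2cnf.
apply: leq_trans (card_assign_false (posx m i) phi).
by rewrite leq_add2l Qlit_posx.
Qed.

Lemma shared_clause_smaller n m (phi : formula n.+1 m) i j C : 2 < n ->
  P_encoding phi ->
  (forall i, #|Q phi i| = 2) ->
  (forall i C, C \in Q phi i -> #|C| = 2) ->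
  i != j -> C \in Q phi i -> negx m j \in C -> smaller_encoding phi n 3.
Proof.
move=> n3 /P_encoding_lit_encoding enc cardQ bin ij CQ Cj.
have [l0 l0i eqC] := Q_binaryP CQ (bin _ _ CQ).
have {l0 l0i} eqC : C = [set negx m i; negx m j].
  move: Cj; rewrite eqC !inE xpair_eqE andbT => /orP[/eqP[eqij]|/eqP-> //].
  by rewrite eqij eqxx in ij.
have /eqP := cardQ i; rewrite (cardsD1 C) CQ eqSS => /cards1P[C' eqQ].
have /setD1P[C'C C'Q] : C' \in Q phi i :\ C by rewrite eqQ set11.
have [l li eqC'] := Q_binaryP C'Q (bin _ _ C'Q).
(* The second clause of [Q phi i] contains neither literal on [x_j], so setting [x_j] to false
   leaves it intact while [C] disappears. *)
have C'j : negx m j \notin C'.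
  apply: contra C'C; rewrite eqC' eqC !inE xpair_eqE andbT.
  by case/orP=> [/eqP[eqij]|/eqP->//]; rewrite eqij eqxx in ij.
have C'p : posx m j \notin C' by apply: Q_posx C'Q (bin _ _ C'Q).
pose phi1 := assign_false (posx m j) phi.
have Q1 D : D \in Qlit phi1 (posx m i) -> D = C'.
  rewrite inE => /andP[/imsetP[E /setDP[Ephi NE] ->] /setD1P[_ Ei]].
  have Ej : negx m j \notin E by move: NE; rewrite inE Ephi.
  have : E \in Q phi i :\ C.
    apply/setD1P; split; last by rewrite inE Ephi.
    by apply: contraNneq Ej => ->.
  rewrite eqQ inE => /eqP->; apply/setP=> t; rewrite !inE.
  by have [->|//] := eqVneq; rewrite (negPf C'p).
have C'phi1 : C' \in phi1.
  apply/imsetP; exists C'.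
    rewrite !inE (negPf C'j) andbF /=.
    by move: C'Q; rewrite inE => /andP[].
  apply/setP=> t; rewrite !inE.
  by have [->|//] := eqVneq; rewrite (negPf C'p).
have [i0 eqi|] := unliftP j i; last first.
  by move=> eqij; rewrite eqij eqxx in ij.
have enc1 := lit_encoding_assign_false j enc.
have [|||psi [g [encg two lt]]] := lit_encoding_substitute enc1 (i := i0) (l := l) n3.
- by rewrite /= -eqi; move: C'phi1; rewrite eqC'.
- by rewrite /= -eqi.
- rewrite /= -eqi => D t /Q1-> tC ti _; move: tC.
  by rewrite eqC' !inE (negPf ti) => /eqP.
apply: smaller_encoding_lit encg _ _ => // [/(assign_false_2cnf (p := posx m j))//|].
(* Two clauses are saved with [Q phi j] and one more by the substitution. *)
apply: leq_trans (card_assign_false (posx m j) phi).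
by rewrite Qlit_posx cardQ !addnS !addn0 !ltnS.
Qed.

Lemma smaller_or_regular n m (phi : formula n m) :
  4 <= n -> P_encoding phi -> prime_formula phi ->
  smaller_encoding phi n 1 \/ smaller_encoding phi n.-1 3 \/ regular_form phi.
Proof.
case: n phi => // n phi n3 enc pr; have lit_enc := P_encoding_lit_encoding enc.
have [i many|few] := pickP [pred i | 2 < #|Q phi i|].
  by right; left; apply: many_Q_smaller many.
pose B i := [set C in Q phi i | #|C| == 2].
have [i fewB|manyB] := pickP [pred i | #|B i| <= 1].
  by left; apply: few_binary_smaller fewB => //; apply: ltnW.
have {}few i : #|Q phi i| <= 2 by rewrite leqNgt; have /= -> := few i.
have {}manyB i : 1 < #|B i| by rewrite ltnNge; have /= -> := manyB i.
(* At least two binary clauses among at most two clauses: all are binary, which settles (R1) and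
   (R3). *)
have eqB i : B i = Q phi i.
  apply/eqP; rewrite eqEcard; apply/andP; split.
    by apply/subsetP=> C; rewrite inE => /andP[].
  exact: leq_trans (few i) (manyB i).
have cardQ i : #|Q phi i| = 2.
  by apply/eqP; rewrite eqn_leq few -eqB manyB.
have bin i C : C \in Q phi i -> #|C| = 2.
  by rewrite -eqB inE => /andP[_ /eqP].
have [[[i j] C] /and3P[/= ij CQ Cj]|none] :=
  pickP [pred x : 'I_n.+1 * 'I_n.+1 * clause n.+1 m |
    [&& x.1.1 != x.1.2, x.2 \in Q phi x.1.1 & negx m x.1.2 \in x.2]].
  by right; left; apply: shared_clause_smaller ij CQ Cj.
right; right; split=> // i; split=> // [C CQ j b Cj|C]; last exact: bin.
apply/eqP; rewrite eq_sym; apply/negPn/negP=> ij.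
(* For (R2), a foreign negative input would make [C] a shared clause, and a positive one is excluded
   by [Q_posx]. *)
case: b Cj => Cj; last by have := none (i, j, C); rewrite /= ij CQ Cj.
by have := Q_posx lit_enc j CQ (bin _ _ CQ); rewrite Cj.
Qed.

Theorem theorem2 (n m : nat) (phi : formula n m) :
  4 <= n -> P_encoding phi -> prime_formula phi ->
  ((exists (m' : nat) (phi' : formula n m'),
      P_encoding phi' /\ #|phi| >= #|phi'| + 1) \/
   (exists (m' : nat) (phi' : formula n.-1 m'),
      P_encoding phi' /\ #|phi| >= #|phi'| + 3) \/
   regular_form phi) /\
  (is_2cnf phi ->
   (exists (m' : nat) (phi' : formula n m'),
      [/\ P_encoding phi', is_2cnf phi' & #|phi| >= #|phi'| + 1]) \/
   (exists (m' : nat) (phi' : formula n.-1 m'),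
      [/\ P_encoding phi', is_2cnf phi' & #|phi| >= #|phi'| + 3]) \/
   regular_form phi).
Proof.
move=> n4 enc pr; have H := smaller_or_regular n4 enc pr.
(* The 2-CNF claim [t] is an implication attached to the witness, so the same [phi'] serves both
   halves. *)
split=> [|two]; case: H => [[m' [phi' [e t le]]]|[[m' [phi' [e t le]]]|reg]].
- by left; exists m', phi'.
- by right; left; exists m', phi'.
- by right; right.
- by left; exists m', phi'; split=> //; apply: t.
- by right; left; exists m', phi'; split=> //; apply: t.
- by right; right.
Qed.
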